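(* For every integer $n\ge 1$, the reliability polynomial of the Farey graph $G_n$ is $$R(G_n;p)=q^{2^n-1}p^{2^n}\,\frac{2^{n+1}-q^{-n-1}}{(2-q^{-1})^{2^{n-1}}}\prod_{i=2}^{n}\left(2^i-q^{-i}\right)^{2^{n-i}},\qquad q=1-p,$$ as an identity of rational functions in $p$ (an empty product equals $1$; at $q=0$ and $q=1/2$ the right-hand side is understood after cancellation).
   Context: The Farey graphs $G_n$ ($n\ge 0$), each with two distinguished (''special'') vertices $X_n,Y_n$, are defined recursively. $G_0$ is a single edge joining its two special vertices $X_0$ and $Y_0$. For $n\ge 1$, take two disjoint copies $G_{n-1}^1,G_{n-1}^2$ of $G_{n-1}$, with special vertices $X_{n-1}^i,Y_{n-1}^i$ ($i=1,2$); identify $Y_{n-1}^1$ with $X_{n-1}^2$ into one vertex, and add a new edge $e_n$ joining $X_{n-1}^1$ and $Y_{n-1}^2$. The result is $G_n$, with special vertices $X_n=X_{n-1}^1$ and $Y_n=Y_{n-1}^2$. It has $2^n+1$ vertices and $2^{n+1}-1$ edges. For a connected graph $G$, the reliability polynomial $R(G;p)$ is the polynomial in $p$ which, for $0\le p\le 1$, equals the probability that the random spanning subgraph $H$ of $G$, obtained by keeping all vertices and independently retaining each edge of $G$ with probability $p$ (deleting it with probability $1-p$), is connected, i.e. that any two vertices are joined by a path in $H$. *)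

(* Defs.v *)
From HB Require Import structures.
From mathcomp Require Import all_boot all_order all_algebra.

Set Implicit Arguments.
Unset Strict Implicit.
Unset Printing Implicit Defensive.

Import Order.TTheory GRing.Theory Num.Theory.
Local Open Scope ring_scope.

(* Finite undirected graphs with named edges; the order of the two ends of an
   edge is irrelevant (see [adjacent]). *)
Record graph := Graph {
  vertex : finType;
  edge : finType;
  ends : edge -> vertex * vertex }.

Definition adjacent (G : graph) (H : {set edge G}) : rel (vertex G) :=
  fun x y => [exists e in H, (ends e == (x, y)) || (ends e == (y, x))].

(* [H] stands for the spanning subgraph with all vertices of [G] and with edge
   set [H]; [connect] is the reflexive transitive closure. *)
Definition connected_spanning (G : graph) (H : {set edge G}) : bool :=
  [forall x, forall y, connect (adjacent H) x y].

(* The probability of retaining exactly the edges in [H]. The base ring is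
   arbitrary so that [p] may be a number or an indeterminate. *)
Definition retain_prob (A : comNzRingType) (G : graph) (p : A)
    (H : {set edge G}) : A :=
  \prod_(e : edge G) (if e \in H then p else 1 - p).

Definition connected_prob (A : comNzRingType) (G : graph) (p : A) : A :=
  \sum_(H : {set edge G} | connected_spanning H) retain_prob p H.

Definition reliability_poly (R : realFieldType) (G : graph) : {poly R} :=
  connected_prob G 'X.

Lemma retain_prob_sum1 (A : comNzRingType) (G : graph) (p : A) :
  \sum_(H : {set edge G}) retain_prob p H = 1.
Proof.
have -> : 1 = \prod_(e : edge G) (p + (1 - p)).
  by rewrite big1 // => e _; rewrite addrC subrK.
rewrite bigA_distr; apply: eq_bigr => H _.
by apply: eq_bigr => e _; case: ifP.
Qed.

Lemma retain_prob_ge0 (R : realFieldType) (G : graph) (p : R)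
    (H : {set edge G}) : 0 <= p <= 1 -> 0 <= retain_prob p H.
Proof.
by case/andP=> p0 p1; apply: prodr_ge0 => e _; case: ifP; rewrite ?subr_ge0.
Qed.

Lemma reliability_polyE (R : realFieldType) (G : graph) (p : R) :
  (reliability_poly R G).[p] = connected_prob G p.
Proof.
rewrite /reliability_poly /connected_prob horner_sum; apply: eq_bigr => H _.
rewrite /retain_prob horner_prod; apply: eq_bigr => e _.
by case: ifP; rewrite !hornerE.
Qed.

Lemma reliability_poly_unique (R : realFieldType) (G : graph) (P : {poly R}) :
  (forall p, 0 <= p <= 1 -> P.[p] = connected_prob G p) ->
  P = reliability_poly R G.
Proof.
move=> HP; apply/eqP; rewrite -subr_eq0; apply/negPn/negP => nz.
set D := _ - _ in nz.
pose s : seq R := [seq k.+1%:R^-1 | k <- iota 0 (size D)].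
have s_uniq : uniq s.
  rewrite map_inj_uniq ?iota_uniq // => i j /invr_inj /eqP.
  by rewrite eqr_nat eqSS => /eqP.
have s_root : all (root D) s.
  apply/allP => _ /mapP[k _ ->]; rewrite rootE hornerD hornerN.
  rewrite HP ?reliability_polyE ?subrr //.
  by rewrite invr_ge0 ler0n invf_le1 ?ltr0n // ler1n.
by have := max_poly_roots nz s_root s_uniq; rewrite size_map size_iota ltnn.
Qed.

Record special_graph := SpecialGraph {
  underlying :> graph;
  specialX : vertex underlying;
  specialY : vertex underlying }.

Section Glue.

Variables G1 G2 : special_graph.

(* The disjoint union of the vertex sets with [specialY G1] and [specialX G2]
   identified: the identified vertex is represented by [specialY G1], so the
   right summand omits [specialX G2]. *)
Definition glue_vertex : finType :=
  (vertex G1 + {v : vertex G2 | v != specialX G2})%type.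

Definition glue_inl (v : vertex G1) : glue_vertex := inl v.

Definition glue_inr (v : vertex G2) : glue_vertex :=
  if insub v is Some u then inr u else inl (specialY G1).

(* [None] is the new edge. *)
Definition glue_edge : finType := option (edge G1 + edge G2)%type.

Definition glue_ends (e : glue_edge) : glue_vertex * glue_vertex :=
  match e with
  | Some (inl e1) => (glue_inl (ends e1).1, glue_inl (ends e1).2)
  | Some (inr e2) => (glue_inr (ends e2).1, glue_inr (ends e2).2)
  | None => (glue_inl (specialX G1), glue_inr (specialY G2))
  end.

Definition glue : special_graph :=
  @SpecialGraph (Graph glue_ends)
    (glue_inl (specialX G1)) (glue_inr (specialY G2)).

End Glue.

Definition single_edge : special_graph :=
  @SpecialGraph (@Graph bool unit (fun=> (false, true))) false true.

Fixpoint farey (n : nat) : special_graph :=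
  if n is m.+1 then glue (farey m) (farey m) else single_edge.

Lemma card_farey_vertex n : #|vertex (farey n)| = (2 ^ n + 1)%N.
Proof.
elim: n => [|n IHn]; first by rewrite card_bool.
rewrite /= card_sum card_sig cardC1 IHn addn1 /=.
by rewrite expnS mul2n -addnn addn1 addSn.
Qed.

Lemma card_farey_edge n : #|edge (farey n)| = (2 ^ n.+1 - 1)%N.
Proof.
elim: n => [|n IHn]; first by rewrite card_unit.
rewrite /= card_option card_sum IHn [in RHS]expnS mul2n -addnn.
have : (0 < 2 ^ n.+1)%N by rewrite expn_gt0.
by case: (2 ^ n.+1)%N => // k _; rewrite !subn1 addSn addnS.
Qed.

(* Main.v *)
Require Import Defs.
From HB Require Import structures.
From mathcomp Require Import all_boot all_order all_algebra.
From mathcomp Require Import ring.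

Set Implicit Arguments.
Unset Strict Implicit.
Unset Printing Implicit Defensive.

Import Order.TTheory GRing.Theory Num.Theory.
Local Open Scope ring_scope.

(** Connectivity is tested on 2-colourings of the vertices that are constant
    along the retained edges: such a colouring of a glued graph is a pair of
    such colourings of the two parts that agree at the identified vertex.
    A spanning subgraph is connected iff its special vertices [X], [Y] are
    joined and every vertex is joined to [X] or [Y] (it is "covered").  Let [a]
    be the probability of "covered and joined", [b] that of "covered and not
    joined".  Gluing two copies gives [a' = a (a + 2 p b)] and [b' = 2 q a b].
    With [c_i = 2 ^ i - q ^ (- i)], these are solved by [a = K c_(n+1)] and
    [p b = K q 2 ^ n c_1], where [K' = K ^ 2 q c_(n+1)]. *)

(** * Colourings constant along the retained edges *)

Section Connectivity.

Variables (G : graph) (H : {set edge G}).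

Definition constant_along (f : vertex G -> bool) : Prop :=
  {in H, forall e, f (ends e).1 = f (ends e).2}.

Lemma adjacent_sym : symmetric (adjacent H).
Proof. by move=> x y; apply: eq_existsb => e; rewrite orbC. Qed.

Lemma connect_adjacent_sym : connect_sym (adjacent H).
Proof. exact: sym_connect_sym adjacent_sym. Qed.

Lemma adjacent_ends e : e \in H -> adjacent H (ends e).1 (ends e).2.
Proof.
by move=> eH; apply/existsP; exists e; rewrite eH -surjective_pairing eqxx.
Qed.

Lemma constant_along_connect f x y :
  constant_along f -> connect (adjacent H) x y -> f x = f y.
Proof.
move=> fH /connectP[s]; elim: s x => [|z s IHs] x /=; first by move=> _ ->.
case/andP=> /existsP[e /andP[eH exz]] zs ylast; rewrite -(IHs z) //.
by case/orP: exz => /eqP exz; have := fH e eH; rewrite exz.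
Qed.

Lemma connect_constant_along x : constant_along (connect (adjacent H) x).
Proof.
move=> e eH; have e12 := connect1 (adjacent_ends eH).
apply/idP/idP => xe; apply: connect_trans xe _ => //.
by rewrite connect_adjacent_sym.
Qed.

End Connectivity.

(** * Connectivity seen from the two special vertices *)

Section SpecialGraph.

Variables (G : special_graph) (H : {set edge G}).

Definition joined : bool := connect (adjacent H) (specialX G) (specialY G).

Definition covered : bool :=
  [forall v, connect (adjacent H) (specialX G) v
             || connect (adjacent H) (specialY G) v].

(** For the converse, the test colouring is the indicator of the component of [specialX G]. *)
Lemma joinedP :
  reflect (forall f, constant_along H f -> f (specialX G) = f (specialY G))
          joined.
Proof.
apply: (iffP idP) => [XY f fH | all_f]; first exact: constant_along_connect XY.
by rewrite /joined -(all_f _ (@connect_constant_along _ H _)) connect0.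
Qed.

(** For the converse, the test colouring is the indicator of the union of the components of the
    special vertices; it is true at both. *)
Lemma coveredP :
  reflect (forall f, constant_along H f -> f (specialX G) = f (specialY G) ->
             forall v, f v = f (specialX G))
          covered.
Proof.
apply: (iffP forallP) => [cov f fH fXY v | all_f v].
  by case/orP: (cov v) => /(constant_along_connect fH) <-.
pose f v := connect (adjacent H) (specialX G) v
            || connect (adjacent H) (specialY G) v.
have fH : constant_along H f.
  by move=> e eH; rewrite /f !(connect_constant_along _ eH).
by rewrite -[_ || _]/(f v) (all_f f) // /f !connect0 ?orbT.
Qed.

Lemma connected_spanningE : connected_spanning H = covered && joined.
Proof.
apply/forallP/andP => [conn | [/forallP cov XY] x].
  split; last exact: (forallP (conn _)).
  by apply/forallP => v; rewrite (forallP (conn _)).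
have Xto v : connect (adjacent H) (specialX G) v.
  by case/orP: (cov v) => // /(connect_trans XY).
apply/forallP => y; apply: connect_trans (Xto y).
by rewrite connect_adjacent_sym.
Qed.

End SpecialGraph.

(** * Spanning subgraphs of a glued graph *)

Section Glue.

Variables G1 G2 : special_graph.

Definition glue_edges (b : bool) (H1 : {set edge G1}) (H2 : {set edge G2}) :
    {set edge (glue G1 G2)} :=
  [set e : glue_edge G1 G2 | match e with
             | None => b
             | Some (inl e1) => e1 \in H1
             | Some (inr e2) => e2 \in H2
             end].

(** The identified vertex gets its colour from [f1], so [f2] is recovered on all of [G2] only if the
    two agree there. *)
Definition glue_fun (f1 : vertex G1 -> bool) (f2 : vertex G2 -> bool)
    (v : glue_vertex G1 G2) : bool :=
  match v with inl v1 => f1 v1 | inr v2 => f2 (val v2) end.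

Lemma glue_fun_inr f1 f2 v : f1 (specialY G1) = f2 (specialX G2) ->
  glue_fun f1 f2 (glue_inr G1 v) = f2 v.
Proof.
by rewrite /glue_inr; case: insubP => [u _ <- // | /negPn/eqP -> //].
Qed.

Lemma glue_inr_specialX :
  glue_inr G1 (specialX G2) = glue_inl G2 (specialY G1).
Proof. by rewrite /glue_inr insubF ?eqxx. Qed.

Lemma glue_inr_val (u : {v : vertex G2 | v != specialX G2}) :
  glue_inr G1 (val u) = inr u.
Proof. by rewrite /glue_inr valK. Qed.

Section GlueEdges.

Variables (b : bool) (H1 : {set edge G1}) (H2 : {set edge G2}).

Let H := glue_edges b H1 H2.

Lemma constant_along_glue (f : vertex (glue G1 G2) -> bool) :
  constant_along H f <->
  [/\ constant_along H1 (f \o @glue_inl G1 G2),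
      constant_along H2 (f \o @glue_inr G1 G2) &
      b -> f (specialX (glue G1 G2)) = f (specialY (glue G1 G2))].
Proof.
split=> [fH | [f1 f2 fb]].
  split=> [e eH | e eH | bT].
  - by apply: (fH (Some (inl e))); rewrite inE.
  - by apply: (fH (Some (inr e))); rewrite inE.
  - by apply: (fH None); rewrite inE.
case=> [[e|e]|]; rewrite inE => eH; [exact: f1 | exact: f2 | exact: fb].
Qed.

Lemma constant_along_glue_fun f1 f2 : f1 (specialY G1) = f2 (specialX G2) ->
  constant_along H1 f1 -> constant_along H2 f2 ->
  (b -> f1 (specialX G1) = f2 (specialY G2)) ->
  constant_along H (glue_fun f1 f2).
Proof.
move=> f12 f1H f2H fb; apply/constant_along_glue; split=> [|e eH|] //.
  by rewrite /= !glue_fun_inr ?f2H.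
by move/fb; rewrite /= glue_fun_inr.
Qed.

(** The outer special vertices are linked by the new edge or through the identified vertex. If [b]
    is false, a colouring separating the special vertices of one part extends by a constant over the
    other. *)
Lemma joined_glue : joined H = b || (joined H1 && joined H2).
Proof.
apply/joinedP/idP => [jH | ].
  have [//|/negP nb /=] := boolP b; apply/andP; split; apply/joinedP => f fH.
    have := jH (glue_fun f (fun=> f (specialY G1))).
    rewrite /= glue_fun_inr //; apply.
    exact: constant_along_glue_fun.
  have := jH (glue_fun (fun=> f (specialX G2)) f).
  rewrite /= glue_fun_inr //; apply.
  exact: constant_along_glue_fun.
move=> jH f /constant_along_glue[f1 f2 fb].
case/orP: jH => [/fb // | /andP[/joinedP/(_ _ f1) j1 /joinedP/(_ _ f2) j2]].
by rewrite /= in j1 j2 *; rewrite j1 -j2 glue_inr_specialX.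
Qed.

(** The new edge links two vertices that both count as sources already, so [b] drops out. The
    disjunction says that the identified vertex is reached from an outer one. *)
Lemma covered_glue :
  covered H = [&& covered H1, covered H2 & joined H1 || joined H2].
Proof.
apply/coveredP/and3P => [cH | [/coveredP c1 /coveredP c2 j12] f].
  split.
  - apply/coveredP => f fH fXY v.
    have := cH (glue_fun f (fun=> f (specialY G1))) _ _ (inl v).
    by rewrite /= glue_fun_inr //; apply=> //; apply: constant_along_glue_fun.
  - apply/coveredP => f fH fXY v.
    have := cH (glue_fun (fun=> f (specialX G2)) f) _ _ (glue_inr G1 v).
    by rewrite /= !glue_fun_inr //; apply=> //; apply: constant_along_glue_fun.
  apply/orP; have [j1|/joinedP nj1] := boolP (joined H1); [by left | right].
  apply/joinedP => f2 f2H; apply/eqP; apply/negPn/negP => f2XY.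
  case: nj1 => f1 f1H; apply/eqP; apply/negPn/negP => f1XY.
  (* Up to exchanging the two colours in [f1], the colourings agree at the
     identified vertex, hence, there being only two colours, also at the
     outer special vertices. *)
  pose s := f1 (specialY G1) (+) f2 (specialX G2).
  pose g1 v := s (+) f1 v.
  have g12 : g1 (specialY G1) = f2 (specialX G2).
    by rewrite /g1 /s addbAC addbb.
  have g1H : constant_along H1 g1 by move=> e eH; rewrite /g1 f1H.
  have g1XY : g1 (specialX G1) = f2 (specialY G2).
    rewrite /g1 /s; move: f1XY f2XY.
    case: (f1 (specialX G1)); case: (f1 (specialY G1)) => //;
    by case: (f2 (specialX G2)); case: (f2 (specialY G2)).
  (* At the identified vertex, [cH] makes [f2] equal at the special vertices of [G2], against
     [f2XY]. *)
  have := cH (glue_fun g1 f2) _ _ (inl (specialY G1)).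
  rewrite /= glue_fun_inr // g12 g1XY.
  by move=> /(_ (constant_along_glue_fun _ _ _ _)) /= E; rewrite E ?eqxx in f2XY.
case/constant_along_glue=> f1 f2 _ /= fXY.
(* Whichever part is joined carries the common outer colour to the identified vertex, so covering
   applies in both parts. *)
have fY1 : f (glue_inl G2 (specialX G1)) = f (glue_inl G2 (specialY G1)).
  case/orP: j12 => /joinedP; first by move/(_ _ f1).
  by move/(_ _ f2); rewrite /= glue_inr_specialX fXY => ->.
have fX2 : f (glue_inr G1 (specialX G2)) = f (glue_inr G1 (specialY G2)).
  by rewrite glue_inr_specialX -fY1.
case=> [v|u]; first exact: (c1 _ f1).
by have /= := c2 _ f2 fX2 (val u); rewrite glue_inr_val => ->; rewrite fX2.
Qed.

Lemma retain_prob_glue (A : comNzRingType) (p : A) :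
  retain_prob p H = (if b then p else 1 - p)
                    * (retain_prob p H1 * retain_prob p H2).
Proof.
rewrite /retain_prob (bigD1 None) //=; congr (_ * _); first by rewrite inE.
rewrite (reindex_omap Some id) /=; last by case.
under eq_bigl => e do rewrite eqxx.
by rewrite big_sumType; congr (_ * _); apply: eq_bigr => e _; rewrite inE.
Qed.

End GlueEdges.

(** Splitting an edge set into its traces on the parts and on the new edge inverts [glue_edges]. *)
Lemma sum_glue_edges (A : nmodType) (F : {set edge (glue G1 G2)} -> A) :
  \sum_H F H = \sum_H1 \sum_H2 (F (glue_edges true H1 H2)
                                + F (glue_edges false H1 H2)).
Proof.
transitivity (\sum_H1 \sum_H2 \sum_(b : bool) F (glue_edges b H1 H2)); last first.
  by apply: eq_bigr => H1 _; apply: eq_bigr => H2 _; rewrite big_bool.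
rewrite (eq_bigr _ (fun H1 _ => pair_bigA _ (fun H2 b => F (glue_edges b H1 H2)))).
rewrite pair_bigA /=.
pose split_edges (H : {set edge (glue G1 G2)}) :=
  ([set e | Some (inl e) \in H], ([set e | Some (inr e) \in H], None \in H)).
rewrite (reindex (fun t => glue_edges t.2.2 t.1 t.2.1)) //.
exists split_edges => [[H1 [H2 b]] _ | H _] /=.
  by congr (_, (_, _)); [apply/setP => e| apply/setP => e|]; rewrite !inE.
by apply/setP => [[[e|e]|]]; rewrite !inE.
Qed.

End Glue.

(** * Recurrences for the two probabilities *)

Section SplitProb.

Variables (A : comNzRingType) (p : A).

(** The event is that there are exactly two components, each containing one special vertex. *)
Definition split_prob (G : special_graph) : A :=
  \sum_(H : {set edge G} | covered H && ~~ joined H) retain_prob p H.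

Lemma connected_prob_covered (G : special_graph) :
  connected_prob G p =
  \sum_(H : {set edge G}) (covered H && joined H)%:R * retain_prob p H.
Proof.
rewrite /connected_prob big_mkcond; apply: eq_bigr => H _.
by rewrite connected_spanningE; case: ifP; rewrite ?mul1r ?mul0r.
Qed.

Lemma split_prob_covered (G : special_graph) :
  split_prob G =
  \sum_(H : {set edge G}) (covered H && ~~ joined H)%:R * retain_prob p H.
Proof.
rewrite /split_prob big_mkcond; apply: eq_bigr => H _.
by case: ifP; rewrite ?mul1r ?mul0r.
Qed.

(** With both parts covered, either both are joined and the new edge is arbitrary, of total weight
    1, or exactly one is joined and the new edge is retained. *)
Lemma connected_prob_glue (G1 G2 : special_graph) :
  connected_prob (glue G1 G2) p =
  connected_prob G1 p * connected_prob G2 p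
  + p * (connected_prob G1 p * split_prob G2 + split_prob G1 * connected_prob G2 p).
Proof.
rewrite !connected_prob_covered !split_prob_covered sum_glue_edges.
rewrite !big_distrlr -big_split mulr_sumr -big_split.
apply: eq_bigr => H1 _; rewrite -big_split mulr_sumr -big_split.
apply: eq_bigr => H2 _; rewrite !retain_prob_glue !covered_glue !joined_glue /=.
by case: (covered H1); case: (covered H2); case: (joined H1); case: (joined H2);
  rewrite /=; ring.
Qed.

(** Here exactly one part is joined and the new edge is deleted. *)
Lemma split_prob_glue (G1 G2 : special_graph) :
  split_prob (glue G1 G2) =
  (1 - p) * (connected_prob G1 p * split_prob G2
             + split_prob G1 * connected_prob G2 p).
Proof.
rewrite !connected_prob_covered !split_prob_covered sum_glue_edges.
rewrite !big_distrlr -big_split mulr_sumr.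
apply: eq_bigr => H1 _; rewrite -big_split mulr_sumr.
apply: eq_bigr => H2 _; rewrite !retain_prob_glue !covered_glue !joined_glue /=.
by case: (covered H1); case: (covered H2); case: (joined H1); case: (joined H2);
  rewrite /=; ring.
Qed.

Lemma sum_single_edge (F : {set edge single_edge} -> A) :
  \sum_H F H = F setT + F set0.
Proof.
rewrite (bigD1 setT) //= (bigD1 set0) ?addrA; last first.
  by apply/eqP => /setP E; have := E tt; rewrite !inE.
rewrite big1 ?addr0 // => H /andP[HT H0].
have [ttH|ttH] := boolP (tt \in H).
  by case/eqP: HT; apply/setP => -[]; rewrite inE.
by case/eqP: H0; apply/setP => -[]; rewrite inE; apply/negbTE.
Qed.

Lemma covered_single_edge (H : {set edge single_edge}) : covered H.
Proof. by apply/forallP => -[]; rewrite connect0 ?orbT. Qed.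

Lemma joined_single_edge (H : {set edge single_edge}) : joined H = (tt \in H).
Proof.
apply/joinedP/idP => [jH | ttH f fH]; last exact: (fH tt).
apply/negPn/negP => /negP ttH.
by have /jH : constant_along H (id : vertex single_edge -> bool) by case.
Qed.

Lemma connected_prob_single_edge : connected_prob single_edge p = p.
Proof.
rewrite connected_prob_covered sum_single_edge !covered_single_edge.
rewrite !joined_single_edge !inE /retain_prob mul0r addr0 mul1r.
by rewrite (bigD1 tt) //= inE big1 ?mulr1 // => -[].
Qed.

Lemma split_prob_single_edge : split_prob single_edge = 1 - p.
Proof.
rewrite split_prob_covered sum_single_edge !covered_single_edge.
rewrite !joined_single_edge !inE /retain_prob mul0r add0r mul1r.
by rewrite (bigD1 tt) //= inE big1 ?mulr1 // => -[].
Qed.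

End SplitProb.

(** This carries the reliability polynomial into the field of fractions, where the closed form makes
    sense. *)
Lemma rmorph_connected_prob (A B : comNzRingType) (f : {rmorphism A -> B})
    (G : graph) (p : A) : f (connected_prob G p) = connected_prob G (f p).
Proof.
rewrite rmorph_sum; apply: eq_bigr => H _; rewrite rmorph_prod.
by apply: eq_bigr => e _; case: ifP => _ //; rewrite rmorphB rmorph1.
Qed.

(** * Solving the recurrences over a field *)

Section ClosedForm.

Variables (F : fieldType) (p : F).

Let q := 1 - p.
Let c i : F := 2 ^+ i - q ^- i.
Let K n : F := q ^+ (2 ^ n - 1) * p ^+ (2 ^ n) / c 1 ^+ (2 ^ n.-1)
               * \prod_(2 <= i < n.+1) c i ^+ (2 ^ (n - i)).

Hypotheses (q_neq0 : q != 0) (two_p_neq1 : 1 - p *+ 2 != 0).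

Let c1_neq0 : c 1 != 0.
Proof.
have -> : c 1 = (1 - p *+ 2) / q by rewrite /c /q; field.
by rewrite mulf_neq0 ?invr_neq0.
Qed.

(** Squaring doubles every exponent; the extra [q] makes up the odd exponent of [q], and [c n.+2] is
    the new last factor of the product. *)
Lemma farey_factorS n : K n.+2 = K n.+1 ^+ 2 * q * c n.+2.
Proof.
rewrite /K big_nat_recr //= subnn expn0 expr1.
rewrite (eq_big_nat _ _ (F2 := fun i => (c i ^+ (2 ^ (n.+1 - i))) ^+ 2)); last first.
  by move=> i /andP[_ lt_i_n]; rewrite -exprM -expnSr subSn.
have -> : (2 ^ n.+2 - 1 = (2 ^ n.+1 - 1) * 2 + 1)%N.
  have : (0 < 2 ^ n.+1)%N by rewrite expn_gt0.
  by rewrite (expnSr 2 n.+1); case: (2 ^ n.+1)%N => // k _; rewrite mulSn !subn1 addn1.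
rewrite prodrXl (expnSr 2 n.+1) (expnSr 2 n) !exprD !exprM.
by field; rewrite expf_neq0.
Qed.

(** The recurrences are coupled, so both are solved together. Stating the second for
    [p * split_prob] avoids dividing by [p], which may vanish. *)
Lemma farey_probE n :
  connected_prob (farey n.+1) p = K n.+1 * c n.+2 /\
  p * split_prob p (farey n.+1) = K n.+1 * q * 2 ^+ n.+1 * c 1.
Proof.
elim: n => [|n [IHc IHs]].
  rewrite [farey 1]/= connected_prob_glue split_prob_glue.
  rewrite connected_prob_single_edge split_prob_single_edge.
  have -> : K 1 = q * p ^+ 2 / c 1 by rewrite /K big_geq // mulr1.
  (* A difference of squares; its factor [c 1] cancels the denominator of [K 1]. *)
  have -> : c 2 = c 1 * (2 + q^-1) by rewrite /c -!exprVn; ring.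
  rewrite -/q; move: (c 1) c1_neq0 (q) q_neq0 => c1 c1_nz r r_nz.
  by split; field; rewrite ?r_nz.
set a := connected_prob _ p in IHc; set b := split_prob p _ in IHs.
rewrite farey_factorS (_ : farey n.+2 = glue (farey n.+1) (farey n.+1)) //.
rewrite connected_prob_glue split_prob_glue -/a -/b -/q.
split.
  (* This identity turns the factor [a + 2 * (p * b)] into [K n.+1 * (q * c n.+3)]. *)
  have cE : q * c n.+3 = c n.+2 + 2 * (q * 2 ^+ n.+1 * c 1).
    rewrite /c -!exprVn (exprS 2 n.+2) (exprS 2 n.+1) (exprS q^-1 n.+2).
    move: (2 ^+ n.+1) (q^-1 ^+ n.+2) (q) q_neq0 => x y r r_nz.
    by field.
  have -> : a * a + p * (a * b + b * a) = a * (a + 2 * (p * b)) by ring.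
  have -> : K n.+1 ^+ 2 * q * c n.+2 * c n.+3 = K n.+1 ^+ 2 * c n.+2 * (q * c n.+3).
    by ring.
  by rewrite cE IHc IHs; ring.
rewrite (_ : p * _ = 2 * q * a * (p * b)); last by ring.
by rewrite IHc IHs (exprS 2 n.+1); ring.
Qed.

Lemma connected_prob_farey n : (0 < n)%N ->
  connected_prob (farey n) p =
  q ^+ (2 ^ n - 1) * p ^+ (2 ^ n)
  * ((2 ^+ n.+1 - q ^- n.+1) / (2 - q^-1) ^+ (2 ^ n.-1))
  * \prod_(2 <= i < n.+1) (2 ^+ i - q ^- i) ^+ (2 ^ (n - i)).
Proof.
case: n => // n _; rewrite (farey_probE n).1 /K -/(c n.+2) -[2 - q^-1]/(c 1).
by rewrite mulrAC; congr (_ * _); rewrite -!mulrA [_^-1 * _]mulrC.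
Qed.

End ClosedForm.

Theorem mainTheorem5 (R : realFieldType) (n : nat) (n_ge1 : (1 <= n)%N) :
  let p : {fraction {poly R}} := FracField.tofrac 'X in
  let q : {fraction {poly R}} := 1 - p in
  FracField.tofrac (reliability_poly R (farey n)) =
    q ^+ (2 ^ n - 1) * p ^+ (2 ^ n)
    * ((2 ^+ n.+1 - q ^- n.+1) / (2 - q^-1) ^+ (2 ^ n.-1))
    * \prod_(2 <= i < n.+1) (2 ^+ i - q ^- i) ^+ (2 ^ (n - i)).
Proof.
move=> p q; rewrite rmorph_connected_prob -/p.
(* Applied to [1 - 'X] and [1 - 'X *+ 2], this gives the two nonvanishing hypotheses of the closed
   form. *)
have frac_neq0 (P : {poly R}) : P.[0] = 1 -> FracField.tofrac P != 0.
  move=> P0; rewrite tofrac_eq0; apply: contra_eq_neq P0 => ->.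
  by rewrite horner0 eq_sym oner_neq0.
rewrite connected_prob_farey //.
  by rewrite /p -tofrac1 -tofracB frac_neq0 // hornerD hornerN hornerX hornerC subr0.
rewrite /p -tofracMn -tofrac1 -tofracB frac_neq0 //.
by rewrite hornerD hornerN hornerMn hornerX hornerC mul0rn subr0.
Qed.
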